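(* Let $d\ge1$ be an integer, let $\delta>0$, and let $\{x_j\}_{j=0}^{d}\subset[0,1]$ be a $\delta$-separated set of points, meaning that $|x_i-x_j|\ge\delta$ for $i\neq j$. If $p$ is a polynomial of degree $d$ (with real or complex coefficients) and $L\ge1$, then $$|p(L)|\le\left(e^2(\delta d)^{-1}L\right)^d\max_{0\le j\le d}|p(x_j)|.$$ *)

(* Defs.v *)
From mathcomp Require Import all_boot all_order all_algebra.
From mathcomp Require Import complex.
From mathcomp Require Import all_classical all_reals all_analysis.

Set Implicit Arguments.
Unset Strict Implicit.
Unset Printing Implicit Defensive.

Import Order.TTheory GRing.Theory Num.Theory.

Local Open Scope ring_scope.

Definition delta_separated (R : realType) (I : Type) (delta : R) (x : I -> R)
    : Prop :=
  forall i j : I, i <> j -> delta <= `|x i - x j|.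

(* The modulus |p(t)| at a real point t. The library's [`|z|] on [R[i]] takes
   values in [R[i]], hence [Normc.normc], which takes values in [R]. Real
   coefficients are covered through [map_poly (real_complex R)]. *)
Definition abs_horner (R : realType) (p : {poly R[i]}) (t : R) : R :=
  Normc.normc p.[real_complex R t].

(* Main.v *)
Require Import Defs.
From mathcomp Require Import all_boot all_order all_algebra.
From mathcomp Require Import complex.
From mathcomp Require Import all_classical all_reals all_analysis.
From mathcomp Require Import fingroup perm.
Import Order.TTheory GRing.Theory Num.Theory.
Local Open Scope ring_scope.

(** Lagrange interpolation at the [d + 1] nodes expresses [p(L)] through the
    values [p(x_j)] with weights [\prod_(k != j) (L - x_k) / (x_j - x_k)].  The
    numerators are at most [L ^ d].  After sorting the nodes,
    [|x_j - x_k| >= delta |j - k|], so the denominators are at least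
    [delta ^ d * j! * (d - j)!], and the binomial theorem bounds the sum of the
    weights by [(2 L / delta) ^ d / d!].  Conclude with [d! >= (d / e) ^ d] and
    [2 <= e]. *)

(** The sorted tuple of values is a permutation of the original one, and that permutation serves as
    [s]. *)
Lemma sort_ord (R : realType) (n : nat) (x : 'I_n -> R) :
  exists s : 'S_n, {homo (x \o s) : i j / (i <= j)%N >-> i <= j}.
Proof.
pose t := [tuple x i | i < n].
have /tuple_permP[s est] : perm_eq (sort <=%R t) t by rewrite perm_sort.
exists s => i j ij.
have nthE (k : 'I_n) : nth 0 (sort <=%R t) k = x (s k).
  by rewrite est -tnth_nth !tnth_mktuple.
rewrite /= -!nthE.
apply: (sorted_leq_nth le_trans le_refl 0 (sort_sorted le_total t)) => //.
  by rewrite inE size_sort size_tuple.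
by rewrite inE size_sort size_tuple.
Qed.

(** Induction on the larger index: each gap between consecutive sorted points is at least [delta],
    and the gaps add up. *)
Lemma delta_separated_sorted (R : realType) (n : nat) (delta : R)
    (y : 'I_n -> R) :
  delta_separated delta y -> {homo y : i j / (i <= j)%N >-> i <= j} ->
  forall i j : 'I_n, (i <= j)%N -> delta * (j - i)%:R <= y j - y i.
Proof.
move=> ysep yle i [m hm] /=; elim: m hm => [|m IH] hm.
  rewrite leqn0 => /eqP i0; rewrite i0 subn0 mulr0.
  by rewrite (_ : Ordinal hm = i) ?subrr //; apply/val_inj; rewrite /= i0.
rewrite leq_eqVlt => /predU1P[im|].
  rewrite im subnn mulr0 (_ : Ordinal hm = i) ?subrr //.
  by apply/val_inj; rewrite /= im.
rewrite ltnS => im; rewrite subSn // -addn1 natrD mulrDr mulr1.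
have := IH (ltnW hm) im.
have mle : y (Ordinal (ltnW hm)) <= y (Ordinal hm) by apply: yle => /=.
have := ysep (Ordinal hm) (Ordinal (ltnW hm)).
rewrite ger0_norm ?subr_ge0 // => hsep IHm.
have {}hsep : delta <= y (Ordinal hm) - y (Ordinal (ltnW hm)).
  by apply: hsep => /(congr1 val)/= /eqP; rewrite eqn_leq ltnn.
by have := lerD IHm hsep; rewrite [leRHS]addrC addrA subrK.
Qed.

(** With truncated subtraction, [(j - k) + (k - j)] is the distance between [j] and [k]. The indices
    below [j] contribute [j!], those above it [(n - j)!]. *)
Lemma prod_dist_ord (n : nat) (j : 'I_n.+1) :
  (\prod_(k < n.+1 | k != j) ((j - k) + (k - j)) = j`! * (n - j)`!)%N.
Proof.
rewrite (bigID (fun k : 'I_n.+1 => (k < j)%N)) /=; congr muln.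
  transitivity (\prod_(k < n.+1 | (k < j)%N) (j - k))%N.
    apply: eq_big => [k|k /andP[_ kj]].
      by rewrite -val_eqE /= ltn_neqAle andbA andbb.
    by rewrite (eqP (ltnW kj)) addn0.
  rewrite -(big_ord_widen n.+1 (fun k => j - k)%N (ltnW (ltn_ord j))).
  (* Reversing the index turns the factors [j - k] into [1, ..., j]. *)
  rewrite fact_prod big_add1 big_mkord (reindex_inj rev_ord_inj) /=.
  by apply: eq_bigr => k _; rewrite subKn.
transitivity (\prod_(k < n.+1 | (j < k)%N) (k - j))%N.
  apply: eq_big => [k|k /andP[_]]; first by rewrite -leqNgt ltn_neqAle eq_sym.
  by rewrite -leqNgt => /eqP ->; rewrite add0n.
rewrite -(big_mkord (fun k => j < k)%N (fun k => k - j)%N).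
rewrite (@big_cat_nat _ _ _ j.+1) //= big_nat_cond big_pred0 ?mul1n; last first.
  by move=> k /=; case: ltngtP; rewrite ?andbF // ltnS leqNgt => ->.
rewrite big_nat_cond (eq_bigl (fun k => (j.+1 <= k < n.+1)%N)); last first.
  by move=> k; case: (ltnP j k); rewrite ?andbT ?andbF.
rewrite -big_nat -[j.+1]add0n big_addn subSS fact_prod big_add1.
by apply: eq_bigr => k _; rewrite addnS subSn ?leq_addl // addnK.
Qed.

(** The difference between [p] and its interpolant has size at most [n] and vanishes at [n] distinct
    nodes, so it is zero. *)
Lemma horner_lagrange (F : fieldType) (n : nat) (x : 'I_n -> F) (p : {poly F})
    (t : F) : injective x -> (size p <= n)%N ->
  p.[t] = \sum_(j < n) p.[x j] * \prod_(k < n | k != j) ((t - x k) / (x j - x k)).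
Proof.
move=> xinj sp.
pose l j := \prod_(k < n | k != j) ('X - (x k)%:P).
pose w j := p.[x j] * \prod_(k < n | k != j) (x j - x k)^-1.
have hornerl j u : (w j *: l j).[u] =
    p.[x j] * \prod_(k < n | k != j) ((u - x k) / (x j - x k)).
  rewrite hornerZ /w -mulrA; congr (_ * _); rewrite /l horner_prod -big_split /=.
  by apply: eq_bigr => k _; rewrite hornerXsubC mulrC.
suff /eqP : p - \sum_j w j *: l j = 0.
  rewrite subr_eq0 => /eqP {1}->; rewrite horner_sum.
  by apply: eq_bigr => j _; exact: hornerl.
apply: (@roots_geq_poly_eq0 _ _ (codom x)).
- apply/allP => _ /codomP[i ->]; rewrite /root hornerD hornerN horner_sum.
  rewrite (bigD1 i) //= hornerl big1 ?mulr1 => [|k ki]; last first.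
    by rewrite divff // subr_eq0 (inj_eq xinj) eq_sym.
  rewrite big1 ?addr0 ?subrr // => j ji.
  by rewrite hornerl (bigD1 i) 1?eq_sym //= subrr !mul0r mulr0.
- by rewrite map_inj_uniq ?enum_uniq.
rewrite size_codom card_ord (leq_trans (size_polyD _ _)) // geq_max sp size_polyN.
apply: (leq_trans (size_sum _ _ _)); apply/bigmax_leqP => j _.
rewrite (leq_trans (size_scale_leq _ _)) // /l -big_filter size_prod_XsubC.
rewrite size_filter -sum1_count sum1_card cardC1 card_ord.
(* The product of [n.-1] linear factors has size [n.-1.+1], which is [n] because the index [j]
   forces [0 < n]. *)
by rewrite prednK // (leq_trans _ (ltn_ord j)).
Qed.

(** Induction on [n], using [(1 + 1/m)^m <= e] in the division-free form [step], which also covers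
    [m = 0]. *)
Lemma exprn_le_fact (R : realType) (n : nat) :
  n%:R ^+ n <= expR 1 ^+ n * n`!%:R :> R.
Proof.
have step m : m.+1%:R ^+ m <= expR 1 * m%:R ^+ m :> R.
  case: m => [|m]; first by rewrite !expr0 mulr1 -expR0 ler_expR.
  have -> : expR 1 = expR (m.+1%:R^-1) ^+ m.+1 :> R.
    by rewrite -expRM_natl divff // pnatr_eq0.
  rewrite -exprMn lerXn2r ?nnegrE ?mulr_ge0 ?expR_ge0 ?ler0n //.
  have -> : m.+2%:R = (1 + m.+1%:R^-1) * m.+1%:R :> R.
    by rewrite mulrDl mul1r mulVf ?pnatr_eq0 // natr1.
  by rewrite ler_wpM2r ?ler0n // expR_ge1Dx.
elim: n => [|n IH]; first by rewrite !expr0 mulr1.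
rewrite exprS factS natrM exprS [leRHS]mulrCA ler_wpM2l ?ler0n //.
by rewrite (le_trans (step n)) // -mulrA ler_wpM2l ?expR_ge0.
Qed.

(** Expand [(1 + 1)^n] by the binomial theorem and divide by [n!]. *)
Lemma sum_inv_fact (R : realType) (n : nat) :
  \sum_(j < n.+1) (j`! * (n - j)`!)%:R^-1 = 2 ^+ n / n`!%:R :> R.
Proof.
have -> : 2 = 1 + 1 :> R by [].
rewrite exprDn big_distrl /=; apply: eq_bigr => j _.
have jn : (j <= n)%N by rewrite -ltnS.
rewrite !expr1n mulr1 -(bin_fact jn) [in RHS]natrM invfM mulrA divff ?mul1r //.
by rewrite pnatr_eq0 -lt0n bin_gt0.
Qed.

Lemma normc_ge0 (R : realType) (z : R[i]) : 0 <= Normc.normc z.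
Proof. by case: z => a b; exact: sqrtr_ge0. Qed.

Lemma normc_real (R : realType) (r : R) : Normc.normc (real_complex R r) = `|r|.
Proof. by rewrite /= expr0n addr0 sqrtr_sqr. Qed.

Lemma normc_sum (R : realType) (I : finType) (F : I -> R[i]) :
  Normc.normc (\sum_i F i) <= \sum_i Normc.normc (F i).
Proof.
elim/big_ind2: _ => [|a b c e ab ce|//]; first by rewrite Normc.normc0.
by rewrite (le_trans (le_normcD _ _)) // lerD.
Qed.

Theorem lemma4 (R : realType) (d : nat) (hd : (1 <= d)%N)
  (delta : R) (hdelta : 0 < delta)
  (x : 'I_d.+1 -> R) (hx01 : forall j, 0 <= x j <= 1)
  (hxsep : delta_separated delta x)
  (p : {poly R[i]}) (hp : size p = d.+1)
  (L : R) (hL : 1 <= L) :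
  abs_horner p L <=
    (expR 1 ^+ 2 * (delta * d%:R)^-1 * L) ^+ d
    * \big[Num.max/0]_(j < d.+1) abs_horner p (x j).
Proof.
set M := \big[Num.max/0]_(j < d.+1) _.
have [s sle] := sort_ord _ _ x.
pose y := x \o s.
have ysep : delta_separated delta y.
  by move=> i j ij; apply: hxsep => /perm_inj.
have ydist (j k : 'I_d.+1) :
    delta * ((j - k) + (k - j))%:R <= `|y j - y k|.
  have key := delta_separated_sorted _ _ _ _ ysep sle.
  case: (leqP j k) => [jk|/ltnW jk].
    by rewrite (eqP jk) add0n distrC (le_trans (key _ _ jk)) // ler_norm.
  by rewrite (eqP jk) addn0 (le_trans (key _ _ jk)) // ler_norm.
have dist_gt0 (j k : 'I_d.+1) : k != j -> 0 < delta * ((j - k) + (k - j))%:R.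
  move=> kj; rewrite mulr_gt0 // ltr0n addn_gt0 !subn_gt0.
  by move: kj; rewrite -val_eqE /=; case: ltngtP.
have yinj : injective (real_complex R \o y).
  move=> j k /= [] jk; apply/eqP; apply: contraT => njk.
  have := lt_le_trans (dist_gt0 _ _ njk) (ydist k j).
  by rewrite jk subrr normr0 ltxx.
have weight_le (j : 'I_d.+1) :
    `|\prod_(k < d.+1 | k != j) ((L - y k) / (y j - y k))|
    <= (L / delta) ^+ d * (j`! * (d - j)`!)%:R^-1.
  (* Exactly [d] indices differ from [j], so the bound can be checked factor by factor. *)
  have -> : (L / delta) ^+ d = \prod_(k < d.+1 | k != j) (L / delta).
    by rewrite prodr_const cardC1 card_ord.
  rewrite -prod_dist_ord natr_prod -prodfV -big_split normr_prod.
  apply: ler_prod => k kj; rewrite normr_ge0 /= normrM normfV -mulrA -invfM.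
  have /andP[yk0 yk1] := hx01 (s k).
  apply: ler_pM; rewrite ?normr_ge0 ?invr_ge0 //.
    (* Since [0 <= y k <= 1 <= L], the numerator lies in [[0, L]]. *)
    by rewrite ger0_norm ?subr_ge0 ?(le_trans yk1) // lerBlDr lerDl.
  have dpos := dist_gt0 j k kj.
  by rewrite lef_pV2 ?ydist // posrE // (lt_le_trans dpos).
have M_ge0 : 0 <= M by apply: bigmax_ge_id.
have pM j : abs_horner p (y j) <= M.
  exact: (le_bigmax _ (fun j => abs_horner p (x j))).
have num : 2 ^+ d / d`!%:R <= (expR 1 ^+ 2 / d%:R) ^+ d :> R.
  have e2 : 2 <= expR 1 :> R by apply: expR_ge1Dx.
  have d0 : 0 < d%:R ^+ d :> R by rewrite exprn_gt0 // ltr0n.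
  rewrite ler_pdivrMr ?ltr0n ?fact_gt0 // expr_div_n mulrAC ler_pdivlMr //.
  (* One factor [e^d] absorbs [2^d]; the other, times [d!], absorbs [d^d]. *)
  rewrite expr2 exprMn -mulrA ler_pM ?exprn_ge0 ?exprn_le_fact //.
  by rewrite lerXn2r ?nnegrE ?expR_ge0.
rewrite {1}/abs_horner (horner_lagrange _ _ _ _ (real_complex R L) yinj) ?hp //.
apply: (le_trans (normc_sum _ _ _)).
apply: (@le_trans _ _ (\sum_(j < d.+1)
    M * ((L / delta) ^+ d * (j`! * (d - j)`!)%:R^-1))).
  apply: ler_sum => j _; rewrite Normc.normcM.
  apply: ler_pM; rewrite ?normc_ge0 //; first exact: pM.
  (* The nodes and [L] are real, so each weight is an embedded real number and its modulus is its
     absolute value. *)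
  under eq_bigr do rewrite /= -!rmorphB -fmorphV -rmorphM.
  by rewrite -rmorph_prod normc_real.
rewrite -!big_distrr /= sum_inv_fact mulrC ler_wpM2r //.
have -> : expR 1 ^+ 2 * (delta * d%:R)^-1 * L = L / delta * (expR 1 ^+ 2 / d%:R).
  by rewrite invfM mulrC -mulrA; congr (_ * _); rewrite mulrCA.
by rewrite [leRHS]exprMn ler_wpM2l // exprn_ge0 // divr_ge0 ?ltW // (lt_le_trans ltr01).
Qed.
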